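(* Let $M$ be a persistence module and let $P$ be a bi-graded matrix that is a semi-minimal presentation of $M$. Let $P'$ be the bi-graded matrix obtained from $P$ by the lazy minimization algorithm. Then $P'$ is a minimal presentation of $M$.
   Context: Let $K=\mathbb{Z}_2$ be the field with two elements. A bi-grade (grade) is an element of $\mathbb{Z}^2$, with partial order $(g_x,g_y)\le(h_x,h_y)$ iff $g_x\le h_x$ and $g_y\le h_y$. Co-lexicographic (colex) order compares $y$-coordinates first, then $x$-coordinates. **Bi-graded matrices.** A bi-graded matrix is a (finite) matrix over $K$ whose rows and columns are each annotated with a grade, such that whenever the $(i,j)$-entry is $1$, the grade of row $i$ is $\le$ the grade of column $j$. Rows and columns are always stored in colex order of their grades (those with equal grade in an arbitrary fixed order); indices refer to this order. The pivot of a non-zero column is the largest row index at which it has a non-zero entry. A non-zero column is local if the grade of its pivot row equals the grade of the column. **Persistence modules and presentations.** A persistence module is a $\mathbb{Z}^2$-graded $K[x,y]$-module, where $x$ has degree $(1,0)$ and $y$ has degree $(0,1)$; morphisms are degree-preserving. A basis of a free persistence module is a minimal homogeneous set of generators. A presentation of a persistence module $M$ is a homomorphism $p:F^1\to F^0$ between free persistence modules (here with finite bases) with $\mathrm{coker}(p)\cong M$. Let $q:F^0\to M$ be the canonical map. The presentation is minimal if (1) $q$ maps a basis of $F^0$ bijectively to a minimal homogeneous set of generators of $M$, and (2) $p$ maps a basis of $F^1$ bijectively to a minimal homogeneous set of generators of $\ker(q)$. A presentation is semi-minimal if it can be obtained (up to isomorphism) from a minimal presentation by taking the direct sum with maps of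 the form $\mathrm{id}_H:H\to H$, where $H$ is free. A bi-graded matrix $P$ with row grades $g_{(i)}$ and column grades $g^{(j)}$ represents the homomorphism $p:F^1\to F^0$, where $F^0$ has an ordered basis $(B^0_i)$ with $B^0_i$ in degree $g_{(i)}$, $F^1$ has an ordered basis $(B^1_j)$ with $B^1_j$ in degree $g^{(j)}$, and $p(B^1_j)=\sum_{i:P(i,j)=1}x^{a_{ij}}y^{b_{ij}}B^0_i$ with $(a_{ij},b_{ij})=g^{(j)}-g_{(i)}$. We call $P$ a (minimal, semi-minimal) presentation of $M$ if the homomorphism $p$ is one. **Lazy minimization algorithm.** Input: a bi-graded matrix $P$. It maintains a partial map $\rho$ from row indices to column indices, initially empty. Step 1. Traverse the columns in increasing index order. At column $i$: while column $i$ is non-zero and local, and $\rho(j)$ is defined for its pivot $j$, add column $\rho(j)$ to column $i$ (over $\mathbb{Z}_2$). If, when this loop stops, column $i$ is non-zero and local, let $j$ be its pivot, label column $i$ and row $j$ as local, and set $\rho(j):=i$. Step 2. For each column $c$ not labeled as local, traverse its non-zero row indices in decreasing order: if the current row index $j$ is not labeled local, keep it and proceed to the next smaller non-zero index of the (current) column; if $j$ is labeled local, add column $\rho(j)$ (as it is at the end of Step 1) to column $c$, and proceed to the next smaller non-zero index of the updated column. Step 3. Remove all rows and columns labeled as local, keep the grades of the remaining rows and columns, re-index, and return the resulting bi-graded matrix $P'$. *)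

(* Defs.v *)
From HB Require Import structures.
From mathcomp Require Import all_boot all_order all_algebra.
From mathcomp Require Import generic_quotient ring_quotient.
From mathcomp Require Import boolp classical_sets functions.
From mathcomp Require Import mpoly.
Set Implicit Arguments.
Unset Strict Implicit.
Unset Printing Implicit Defensive.
Import Order.TTheory GRing.Theory Num.Theory.
Local Open Scope ring_scope.
Local Open Scope classical_set_scope.

Notation K := 'F_2.
Notation Kxy := {mpoly 'F_2[2]}.
Definition varx : Kxy := 'X_ord0.
Definition vary : Kxy := 'X_ord_max.

Definition grade : Type := (int * int)%type.

Definition grade_le (g h : grade) : bool := (g.1 <= h.1) && (g.2 <= h.2).

Definition colex_le (g h : grade) : bool :=
  (g.2 < h.2) || ((g.2 == h.2) && (g.1 <= h.1)).

(* The last two fields say that the carrier is the internal direct sum of the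
   components [pm_comp g]. *)
Record persMod := PersMod {
  pm_carrier :> lmodType Kxy;
  pm_comp : grade -> set pm_carrier;
  pm_comp0 : forall g, pm_comp g 0;
  pm_compD : forall g u v, pm_comp g u -> pm_comp g v -> pm_comp g (u + v);
  pm_compZ : forall g (c : K) v, pm_comp g v -> pm_comp g (c%:MP *: v);
  pm_compx : forall g v, pm_comp g v -> pm_comp (g.1 + 1, g.2) (varx *: v);
  pm_compy : forall g v, pm_comp g v -> pm_comp (g.1, g.2 + 1) (vary *: v);
  pm_span : forall v, exists (s : seq grade) (f : grade -> pm_carrier),
    (forall g, pm_comp g (f g)) /\ v = \sum_(g <- s) f g;
  pm_indep : forall (s : seq grade) (f : grade -> pm_carrier),
    uniq s -> (forall g, pm_comp g (f g)) ->
    \sum_(g <- s) f g = 0 -> forall g, g \in s -> f g = 0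
}.

Record pmMor (A B : persMod) := PmMor {
  pmm_fun :> {linear A -> B};
  pmm_deg : forall g v, pm_comp g v -> pm_comp g (pmm_fun v)
}.

Definition pm_iso (A B : persMod) (f : pmMor A B) : Prop :=
  exists f' : pmMor B A, cancel f f' /\ cancel f' f.

Definition homogeneous (M : persMod) : set M := [set v | exists g, pm_comp g v].

Definition lin_span (M : persMod) (S : set M) : set M :=
  [set v | exists (n : nat) (a : 'I_n -> Kxy) (s : 'I_n -> M),
     (forall i, S (s i)) /\ v = \sum_(i < n) a i *: s i].

Definition hom_gens (M : persMod) (N S : set M) : Prop :=
  S `<=` @homogeneous M /\ lin_span S = N.

Definition min_hom_gens (M : persMod) (N S : set M) : Prop :=
  hom_gens N S /\ forall T : set M, T `<=` S -> hom_gens N T -> T = S.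

Lemma pm_compMn (M : persMod) g (v : M) n : pm_comp g v -> pm_comp g (v *+ n).
Proof.
move=> gv; elim: n => [|n IHn]; first by rewrite mulr0n; exact: pm_comp0.
by rewrite mulrS; exact: pm_compD.
Qed.

Lemma pm_compN (M : persMod) g (v : M) : pm_comp g v -> pm_comp g (- v).
Proof. by move=> /(pm_compZ (-1)); rewrite mpolyCN mpolyC1 scaleN1r. Qed.

Lemma pm_span_uniq (M : persMod) (v : M) :
  exists (s : seq grade) (f : grade -> M), [/\ uniq s,
    forall g, pm_comp g (f g), forall g, g \notin s -> f g = 0 &
    v = \sum_(g <- s) f g].
Proof.
have [s [f [fP ->]]] := pm_span v.
exists (undup s), (fun g => f g *+ count_mem g s); split.
- exact: undup_uniq.
- by move=> g; exact: pm_compMn.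
- by move=> g; rewrite mem_undup => gs; rewrite (count_memPn gs).
- by rewrite -big_undup_iterop_count.
Qed.

Lemma sum_supp (V : zmodType) (s t : seq grade) (f : grade -> V) :
  uniq s -> uniq t -> {subset s <= t} -> (forall g, g \notin s -> f g = 0) ->
  \sum_(g <- s) f g = \sum_(g <- t) f g.
Proof.
move=> us ut st f0; rewrite [RHS](bigID (fun g => g \in s)) /=.
rewrite [X in _ = _ + X]big1 ?addr0; last by move=> g; exact: f0.
rewrite -[RHS]big_filter; apply: perm_big; apply: uniq_perm => //.
  exact: filter_uniq.
move=> g; rewrite mem_filter; case: (boolP (g \in s)) => //= gs.
by rewrite (st _ gs).
Qed.

Section DirectSum.
Variables A B : persMod.

Definition dsum_comp (g : grade) : set (A * B)%type :=
  [set v | pm_comp g v.1 /\ pm_comp g v.2].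

Lemma dsum_comp0 g : dsum_comp g 0.
Proof. by split; exact: pm_comp0. Qed.

Lemma dsum_compD g u v :
  dsum_comp g u -> dsum_comp g v -> dsum_comp g (u + v).
Proof. by move=> [u1 u2] [v1 v2]; split; exact: pm_compD. Qed.

Lemma dsum_compZ g (c : K) v : dsum_comp g v -> dsum_comp g (c%:MP *: v).
Proof. by move=> [v1 v2]; split; exact: pm_compZ. Qed.

Lemma dsum_compx g v :
  dsum_comp g v -> dsum_comp (g.1 + 1, g.2) (varx *: v).
Proof. by move=> [v1 v2]; split; exact: pm_compx. Qed.

Lemma dsum_compy g v :
  dsum_comp g v -> dsum_comp (g.1, g.2 + 1) (vary *: v).
Proof. by move=> [v1 v2]; split; exact: pm_compy. Qed.

Lemma sum_pair (s : seq grade) (f : grade -> (A * B)%type) :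
  \sum_(g <- s) f g = (\sum_(g <- s) (f g).1, \sum_(g <- s) (f g).2).
Proof.
elim: s => [|g s IHs]; first by rewrite !big_nil.
by rewrite !big_cons IHs; case: (f g).
Qed.

Lemma dsum_span v : exists (s : seq grade) (f : grade -> (A * B)%type),
  (forall g, dsum_comp g (f g)) /\ v = \sum_(g <- s) f g.
Proof.
case: v => a b.
have [s [f [us fP f0 ->]]] := pm_span_uniq a.
have [t [h [ut hP h0 ->]]] := pm_span_uniq b.
exists (undup (s ++ t)), (fun g => (f g, h g)); split=> //.
have uu := undup_uniq (s ++ t); rewrite sum_pair; congr pair;
  apply: sum_supp => // g; rewrite mem_undup mem_cat => ->; rewrite ?orbT //.
Qed.

Lemma dsum_indep (s : seq grade) (f : grade -> (A * B)%type) :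
  uniq s -> (forall g, dsum_comp g (f g)) ->
  \sum_(g <- s) f g = 0 -> forall g, g \in s -> f g = 0.
Proof.
move=> us fP; rewrite sum_pair => -[s1 s2] g gs.
have f1 := pm_indep us (fun g => proj1 (fP g)) s1 gs.
have f2 := pm_indep us (fun g => proj2 (fP g)) s2 gs.
by rewrite [f g]surjective_pairing f1 f2.
Qed.

Definition dsum : persMod :=
  PersMod dsum_comp0 dsum_compD dsum_compZ dsum_compx dsum_compy
          dsum_span dsum_indep.

End DirectSum.

Section DirectSumMap.
Variables (A B A' B' : persMod) (f : pmMor A A') (h : pmMor B B').

Definition dsum_fun (v : dsum A B) : dsum A' B' := (f v.1, h v.2).

Lemma dsum_fun_linear : linear dsum_fun.
Proof. by move=> c [a b] [a' b']; rewrite /dsum_fun /= !linearP. Qed.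

HB.instance Definition _ :=
  GRing.isLinear.Build Kxy (dsum A B) (dsum A' B') _ dsum_fun dsum_fun_linear.

Lemma dsum_fun_deg g v : pm_comp g v -> pm_comp g (dsum_fun v).
Proof. by move=> [v1 v2]; split; exact: pmm_deg. Qed.

Definition dsum_map : pmMor (dsum A B) (dsum A' B') := PmMor dsum_fun_deg.

End DirectSumMap.

Definition pm_id (A : persMod) : pmMor A A :=
  @PmMor A A idfun (fun g v gv => gv).

Definition pm_compose (A B C : persMod) (f : pmMor B C) (h : pmMor A B) :
  pmMor A C :=
  @PmMor A C (f \o h) (fun g v gv => pmm_deg f (pmm_deg h gv)).

Definition monomial_grade (m : 'X_{1..2}) : grade :=
  ((m ord0)%:Z, (m ord_max)%:Z).

Section FreeModule.
Variables (n : nat) (gr : 'I_n -> grade).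

(* The free module on basis elements [delta_mx i 0] of degree [gr i]. *)
Definition free_comp (g : grade) : set 'cV[Kxy]_n :=
  [set v | forall i m, (v i 0)@_m != 0 -> gr i + monomial_grade m = g].

Lemma free_comp0 g : free_comp g 0.
Proof. by move=> i m; rewrite mxE mcoeff0 eqxx. Qed.

Lemma free_compD g u v :
  free_comp g u -> free_comp g v -> free_comp g (u + v).
Proof.
move=> gu gv i m; rewrite mxE mcoeffD.
have [->|/gu + _] := eqVneq ((u i 0)@_m) 0; last exact.
by rewrite add0r; exact: gv.
Qed.

Lemma free_compZ g (c : K) v : free_comp g v -> free_comp g (c%:MP *: v).
Proof.
move=> gv i m; rewrite mxE mcoeffCM.
have [->|/gv + _] := eqVneq ((v i 0)@_m) 0; last exact.
by rewrite mulr0 eqxx.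
Qed.

Lemma free_compX (g : grade) (v : 'cV[Kxy]_n) (k : 'X_{1..2}) :
  free_comp g v -> free_comp (g + monomial_grade k) ('X_[k] *: v).
Proof.
move=> gv i m; rewrite mxE mulrC -mcoeff_msupp => mv.
move: mv; rewrite (perm_mem (msuppMX (v i 0) k)) => /mapP[m' + ->].
rewrite mcoeff_msupp => /gv <-; rewrite -addrA; congr (_ + _).
by congr pair; rewrite /= mnmDE PoszD addrC.
Qed.

Lemma free_compx g v :
  free_comp g v -> free_comp (g.1 + 1, g.2) (varx *: v).
Proof.
move=> /(free_compX (k := U_(ord0)%MM)); rewrite /monomial_grade !mnm1E /=.
suff -> : g + (1%:Z, 0%:Z) = (g.1 + 1, g.2) by [].
by case: g => g1 g2; congr pair; rewrite /= ?addr0.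
Qed.

Lemma free_compy g v :
  free_comp g v -> free_comp (g.1, g.2 + 1) (vary *: v).
Proof.
move=> /(free_compX (k := U_(ord_max)%MM)); rewrite /monomial_grade !mnm1E /=.
suff -> : g + (0%:Z, 1%:Z) = (g.1, g.2 + 1) by [].
by case: g => g1 g2; congr pair; rewrite /= ?addr0.
Qed.

Lemma free_span v : exists (s : seq grade) (f : grade -> 'cV[Kxy]_n),
  (forall g, free_comp g (f g)) /\ v = \sum_(g <- s) f g.
Proof.
pose d i m := gr i + monomial_grade m.
exists (undup [seq d i m | i <- enum 'I_n, m <- msupp (v i 0)]).
exists (fun g => \col_i \sum_(m <- msupp (v i 0) | d i m == g)
                   (v i 0)@_m *: 'X_[m]).
split=> [g i k|].
  rewrite mxE raddf_sum /=; apply: contra_neq_eq => dk.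
  rewrite big1 // => m dm; rewrite mcoeffZ mcoeffX.
  have [mk|_] := eqVneq m k; last by rewrite mulr0.
  by move: dk; rewrite -mk; move/eqP: dm => <-; rewrite /d eqxx.
apply/colP => i; rewrite summxE.
under eq_bigr do rewrite mxE big_mkcond /=.
rewrite exchange_big /= {1}(mpolyE (v i 0)).
rewrite big_seq [RHS]big_seq; apply: eq_bigr => m mv.
rewrite -big_mkcond /=; under eq_bigl do rewrite eq_sym.
rewrite -big_filter filter_pred1_uniq ?undup_uniq ?big_seq1 // mem_undup.
by apply: allpairs_f_dep => //; rewrite mem_enum.
Qed.

Lemma free_indep (s : seq grade) (f : grade -> 'cV[Kxy]_n) :
  uniq s -> (forall g, free_comp g (f g)) ->
  \sum_(g <- s) f g = 0 -> forall g, g \in s -> f g = 0.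
Proof.
move=> us fP s0 g gs; apply/colP => i; apply/mpolyP => m.
rewrite mxE mcoeff0.
have [-> //|/fP dg] := eqVneq (f g i 0)@_m 0.
move/colP/(_ i)/(congr1 (mcoeff m)): s0.
rewrite summxE mxE mcoeff0 raddf_sum /= (bigD1_seq g) //= big1 ?addr0 //.
move=> h; apply: contra_neq_eq => /fP <-.
exact: dg.
Qed.

Definition free_mod : persMod :=
  PersMod free_comp0 free_compD free_compZ free_compx free_compy
          free_span free_indep.

End FreeModule.

Definition finite_free (F : persMod) : Prop :=
  exists (n : nat) (gr : 'I_n -> grade) (f : pmMor (free_mod gr) F), pm_iso f.

Definition is_basis (F : persMod) (B : set F) : Prop := min_hom_gens setT B.

Section Cokernel.
Variables (A B : persMod) (p : pmMor A B).

Definition im_pred : {pred B} := fun b => `[< exists a, p a = b >].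

Lemma im_pred_zmod : zmod_closed im_pred.
Proof.
split=> [|u v /asboolP[a <-] /asboolP[b <-]]; apply/asboolP.
  by exists 0; rewrite linear0.
by exists (a - b); rewrite linearB.
Qed.

HB.instance Definition _ := GRing.isZmodClosed.Build B im_pred im_pred_zmod.

Definition coker_sort : Type := Quotient.quot im_pred.
HB.instance Definition _ := GRing.Zmodule.on coker_sort.

Definition coker_pi : B -> coker_sort := fun b => (\pi_(Quotient.quot im_pred) b)%qT.

Definition coker_scale (c : Kxy) (u : coker_sort) : coker_sort :=
  coker_pi (c *: repr u).

Lemma coker_piP u v : coker_pi u = coker_pi v <-> exists a, p a = u - v.
Proof.
split=> [/eqP|uv]; last apply/eqP; rewrite -Quotient.idealrBE.
  by move=> /asboolP.
by apply/asboolP.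
Qed.

Lemma coker_reprK u : coker_pi (repr u) = u.
Proof. exact: reprK. Qed.

Lemma coker_piD u v : coker_pi (u + v) = coker_pi u + coker_pi v.
Proof. by rewrite /coker_pi (raddfD (\pi_(Quotient.quot im_pred))%qT). Qed.

Lemma coker_scale_pi c u : coker_scale c (coker_pi u) = coker_pi (c *: u).
Proof.
apply/coker_piP.
have /coker_piP[a pa] := coker_reprK (coker_pi u).
by exists (c *: a); rewrite linearZ_LR pa scalerBr.
Qed.

Lemma coker_scaleA a b v :
  coker_scale a (coker_scale b v) = coker_scale (a * b) v.
Proof. by rewrite -(coker_reprK v) !coker_scale_pi scalerA. Qed.

Lemma coker_scale1 : left_id 1 coker_scale.
Proof. by move=> v; rewrite -(coker_reprK v) coker_scale_pi scale1r. Qed.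

Lemma coker_scaleDr : right_distributive coker_scale +%R.
Proof.
move=> c u v; rewrite -(coker_reprK u) -(coker_reprK v) -coker_piD.
by rewrite !coker_scale_pi scalerDr coker_piD.
Qed.

Lemma coker_scaleDl v : {morph coker_scale^~ v : a b / a + b}.
Proof.
move=> a b; rewrite -(coker_reprK v) !coker_scale_pi scalerDl.
exact: coker_piD.
Qed.

HB.instance Definition _ := GRing.Zmodule_isLmodule.Build Kxy coker_sort
  coker_scaleA coker_scale1 coker_scaleDr coker_scaleDl.

Lemma coker_pi_linear : linear coker_pi.
Proof. by move=> c u v; rewrite coker_piD -coker_scale_pi. Qed.

HB.instance Definition _ :=
  GRing.isLinear.Build Kxy B coker_sort _ coker_pi coker_pi_linear.

Definition coker_comp (g : grade) : set coker_sort :=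
  [set u | exists2 b, pm_comp g b & coker_pi b = u].

Lemma coker_comp0 g : coker_comp g 0.
Proof. by exists 0; [exact: pm_comp0 | rewrite linear0]. Qed.

Lemma coker_compD g u v :
  coker_comp g u -> coker_comp g v -> coker_comp g (u + v).
Proof.
move=> [a ga <-] [b gb <-]; exists (a + b); first exact: pm_compD.
by rewrite linearD.
Qed.

Lemma coker_compZ g (c : K) v : coker_comp g v -> coker_comp g (c%:MP *: v).
Proof.
by move=> [b gb <-]; exists (c%:MP *: b); [exact: pm_compZ | rewrite linearZ].
Qed.

Lemma coker_compx g v :
  coker_comp g v -> coker_comp (g.1 + 1, g.2) (varx *: v).
Proof.
by move=> [b gb <-]; exists (varx *: b); [exact: pm_compx | rewrite linearZ].
Qed.

Lemma coker_compy g v :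
  coker_comp g v -> coker_comp (g.1, g.2 + 1) (vary *: v).
Proof.
by move=> [b gb <-]; exists (vary *: b); [exact: pm_compy | rewrite linearZ].
Qed.

Lemma coker_span v : exists (s : seq grade) (f : grade -> coker_sort),
  (forall g, coker_comp g (f g)) /\ v = \sum_(g <- s) f g.
Proof.
have [s [f [fP vE]]] := pm_span (repr v : B).
exists s, (fun g => coker_pi (f g)); split=> [g|]; first by exists (f g).
by rewrite -linear_sum -vE /= coker_reprK.
Qed.

Lemma coker_indep (s : seq grade) (f : grade -> coker_sort) :
  uniq s -> (forall g, coker_comp g (f g)) ->
  \sum_(g <- s) f g = 0 -> forall g, g \in s -> f g = 0.
Proof.
move=> us /(_ _)/cid2-/all_sig2[b bP bE].
under eq_bigr do rewrite -bE.
rewrite -linear_sum -[RHS](linear0 coker_pi) => /coker_piP[a].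
have [t [h [ut hP h0 ->]]] := pm_span_uniq a.
rewrite subr0 linear_sum /= => E.
pose r := undup (s ++ t); have ur : uniq r by exact: undup_uniq.
pose b' g := if g \in s then b g else 0.
have b's : \sum_(g <- s) b g = \sum_(g <- r) b' g.
  rewrite -(@sum_supp _ s r) //; last 2 first.
  - by move=> g; rewrite mem_undup mem_cat => ->.
  - by move=> g; rewrite /b' => /negPf ->.
  by rewrite big_seq [RHS]big_seq; apply: eq_bigr => g; rewrite /b' => ->.
have hr : \sum_(g <- t) p (h g) = \sum_(g <- r) p (h g).
  apply: sum_supp => // g; first by rewrite mem_undup mem_cat orbC => ->.
  by move=> /h0 ->; rewrite linear0.
have D g : g \in r -> b' g - p (h g) = 0.
  apply: (pm_indep (f := fun g => b' g - p (h g)) ur).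
    move=> {}g; apply: pm_compD; last by apply: pm_compN; exact: pmm_deg.
    by rewrite /b'; case: ifP => // _; exact: pm_comp0.
  by rewrite sumrB -b's -hr E subrr.
move=> g gs; rewrite -bE -(linear0 coker_pi); apply/coker_piP.
exists (h g); rewrite subr0.
have /D/eqP : g \in r by rewrite mem_undup mem_cat gs.
by rewrite subr_eq0 /b' gs => /eqP.
Qed.

Definition coker : persMod :=
  PersMod coker_comp0 coker_compD coker_compZ coker_compx coker_compy
          coker_span coker_indep.

Lemma coker_pi_deg g (v : B) : pm_comp g v -> @pm_comp coker g (coker_pi v).
Proof. by move=> gv; exists v. Qed.

Definition coker_proj : pmMor B coker := @PmMor B coker coker_pi coker_pi_deg.

End Cokernel.

Section Presentation.
Variables (F1 F0 : persMod) (p : pmMor F1 F0) (M : persMod).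

Definition is_presentation : Prop :=
  [/\ finite_free F1, finite_free F0 &
      exists phi : pmMor (coker p) M, pm_iso phi].

(* [q] is the canonical map [F0 -> coker p ~ M]. *)
Definition is_minimal_presentation : Prop :=
  [/\ finite_free F1, finite_free F0 &
      exists2 phi : pmMor (coker p) M, pm_iso phi &
      let q := pm_compose phi (coker_proj p) in
      (exists B : set F0,
         [/\ is_basis B, set_inj B q & min_hom_gens setT (q @` B)]) /\
      (exists B : set F1,
         [/\ is_basis B, set_inj B p &
             min_hom_gens [set v | q v = 0] (p @` B)])].

End Presentation.

(* A direct sum of several identity maps [id_H] is again of the form [id_H], and
   [H] may be zero, so a single [H] suffices. *)
Definition is_semi_minimal_presentation (F1 F0 : persMod) (p : pmMor F1 F0)
    (M : persMod) : Prop :=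
  is_presentation p M /\
  exists (E1 E0 : persMod) (e : pmMor E1 E0) (H : persMod)
         (f1 : pmMor (dsum E1 H) F1) (f0 : pmMor (dsum E0 H) F0),
    [/\ is_minimal_presentation e M, finite_free H, pm_iso f1, pm_iso f0 &
        forall v, p (f1 v) = f0 (dsum_map e (pm_id H) v)].

Record bimat := Bimat {
  nrow : nat;
  ncol : nat;
  rgr : 'I_nrow -> grade;
  cgr : 'I_ncol -> grade;
  bmx :> 'M[K]_(nrow, ncol);
  bmx_le : forall i j, bmx i j != 0 -> grade_le (rgr i) (cgr j);
  rgr_colex : forall i i' : 'I_nrow, (i <= i')%N -> colex_le (rgr i) (rgr i');
  cgr_colex : forall j j' : 'I_ncol, (j <= j')%N -> colex_le (cgr j) (cgr j')
}.

Section Representation.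
Variable P : bimat.

(* [`|_|%N] only turns the exponents into natural numbers: they are nonnegative
   wherever [P i j] is nonzero. *)
Definition rep_mx : 'M[Kxy]_(nrow P, ncol P) :=
  \matrix_(i, j) ((P i j)%:MP *
    (varx ^+ `|(cgr j).1 - (rgr i).1|%N * vary ^+ `|(cgr j).2 - (rgr i).2|%N)).

Definition rep_fun (v : free_mod (@cgr P)) : free_mod (@rgr P) := rep_mx *m v.

Lemma rep_fun_linear : linear rep_fun.
Proof. exact: linearP. Qed.

HB.instance Definition _ := GRing.isLinear.Build Kxy
  (free_mod (@cgr P)) (free_mod (@rgr P)) _ rep_fun rep_fun_linear.

Lemma varXY a b :
  varx ^+ a * vary ^+ b = 'X_[(U_(ord0) *+ a + U_(ord_max) *+ b)%MM].
Proof. by rewrite mpolyXD !mpolyXn. Qed.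

Lemma rep_fun_deg g (v : free_mod (@cgr P)) :
  pm_comp g v -> pm_comp g (rep_fun v).
Proof.
move=> gv i m; rewrite mxE raddf_sum /=; apply: contra_neq_eq => dm.
rewrite big1 // => j _; rewrite mxE -mulrA mcoeffCM varXY.
have [-> |/bmx_le Pij] := eqVneq (P i j) 0; first by rewrite mul0r.
set k := (X in 'X_[X]); rewrite ['X_[k] * _]mulrC.
suff -> : (v j 0 * 'X_[k])@_m = 0 by rewrite mulr0.
apply: contra_neq_eq dm.
rewrite -mcoeff_msupp (perm_mem (msuppMX (v j 0) k)) => /mapP[m' + ->].
rewrite mcoeff_msupp => /gv <-.
case/andP: Pij => le1 le2.
have e01 : (ord0 == ord_max :> 'I_2) = false by [].
rewrite /monomial_grade !mnmDE !mulmnE !mnm1E !eqxx eq_sym e01.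
rewrite !mul1n !mul0n addn0 add0n !PoszD !gez0_abs ?subr_ge0 //.
by congr pair; rewrite /= addrA [_ + (_ - _)]addrC subrK.
Qed.

Definition rep_mor : pmMor (free_mod (@cgr P)) (free_mod (@rgr P)) :=
  PmMor rep_fun_deg.

End Representation.

Section LazyMinimization.
Variable P : bimat.
Let m := nrow P.
Let n := ncol P.

Definition pivot (v : 'cV[K]_m) : option 'I_m :=
  [pick j | (v j 0 != 0) && [forall k : 'I_m, (v k 0 != 0) ==> (k <= j)%N]].

(* The pivot of [v] if [v], seen as a column of grade [g], is nonzero and
   local. *)
Definition local_pivot (g : grade) (v : 'cV[K]_m) : option 'I_m :=
  if pivot v is Some j then if rgr j == g then Some j else None else None.

(* The current matrix and the partial map rho.  A row [j] is labeled as local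
   exactly when [rho j] is set, and a column exactly when it is a value of
   rho, so the labels need not be stored. *)
Definition state : Type := ('M[K]_(m, n) * {ffun 'I_m -> option 'I_n})%type.

Definition set_col (A : 'M[K]_(m, n)) (i : 'I_n) (v : 'cV[K]_m) : 'M[K]_(m, n) :=
  \matrix_(r, c) if c == i then v r 0 else A r c.

Definition reduce1 (st : state) (g : grade) (v : 'cV[K]_m) : 'cV[K]_m :=
  if local_pivot g v is Some j then
    if st.2 j is Some k then v + col k st.1 else v
  else v.

(* The while loop: [reduce1] is the identity once the loop condition fails, and
   otherwise lowers the pivot, as column [rho j] has pivot [j]; hence [m]
   rounds suffice. *)
Definition reduce (st : state) (g : grade) (v : 'cV[K]_m) : 'cV[K]_m :=
  iter m (reduce1 st g) v.

Definition step1_col (st : state) (i : 'I_n) : state :=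
  let v := reduce st (cgr i) (col i st.1) in
  (set_col st.1 i v,
   if local_pivot (cgr i) v is Some j
   then [ffun r => if r == j then Some i else st.2 r]
   else st.2).

Definition step1 : state :=
  foldl step1_col (bmx P, [ffun=> None]) (enum 'I_n).

Definition local_row : pred 'I_m := fun j => step1.2 j != None.
Definition local_col : pred 'I_n := fun c => [exists j, step1.2 j == Some c].

Definition eliminate1 (v : 'cV[K]_m) (j : 'I_m) : 'cV[K]_m :=
  if v j 0 != 0 then
    if step1.2 j is Some k then v + col k step1.1 else v
  else v.

Definition step2_col (c : 'I_n) : 'cV[K]_m :=
  foldl eliminate1 (col c step1.1) (rev (enum 'I_m)).

Definition kept_row : pred 'I_m := predC local_row.
Definition kept_col : pred 'I_n := predC local_col.

Definition lazy_rgr (i : 'I_#|kept_row|) : grade := rgr (enum_val i).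
Definition lazy_cgr (c : 'I_#|kept_col|) : grade := cgr (enum_val c).

(* [enum_val] is increasing, so remaining rows and columns keep their order. *)
Definition lazy_mx : 'M[K]_(#|kept_row|, #|kept_col|) :=
  \matrix_(i, c) step2_col (enum_val c) (enum_val i) 0.

Definition col_le (g : grade) (v : 'cV[K]_m) : Prop :=
  forall j, v j 0 != 0 -> grade_le (rgr j) g.

Definition state_ok (st : state) : Prop :=
  (forall i, col_le (cgr i) (col i st.1)) /\
  (forall j k, st.2 j = Some k -> rgr j = cgr k).

Lemma grade_le_trans : transitive grade_le.
Proof.
move=> g h k /andP[h1 h2] /andP[k1 k2].
by apply/andP; split; [exact: le_trans h1 k1 | exact: le_trans h2 k2].
Qed.

Lemma col_leD g u v : col_le g u -> col_le g v -> col_le g (u + v).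
Proof.
move=> gu gv j; rewrite mxE.
have [->|/gu + _] := eqVneq (u j 0) 0; last by [].
by rewrite add0r; exact: gv.
Qed.

Lemma col_leS g h v : grade_le g h -> col_le g v -> col_le h v.
Proof. by move=> gh gv j /gv jg; exact: grade_le_trans jg gh. Qed.

Lemma grade_le_refl : reflexive grade_le.
Proof. by move=> g; rewrite /grade_le !lexx. Qed.

Lemma local_pivotP g v j : local_pivot g v = Some j -> rgr j = g.
Proof.
rewrite /local_pivot; case: (pivot v) => // k.
by case: eqP => // <- [<-].
Qed.

Lemma reduce_le st g v : state_ok st -> col_le g v -> col_le g (reduce st g v).
Proof.
move=> [A_ok rho_ok] gv.
suff H : forall k, col_le g (iter k (reduce1 st g) v) by exact: H.
elim=> //= k IHk.
set w := iter _ _ _ in IHk *; rewrite /reduce1.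
case E: (local_pivot g w) => [j|//]; case F: (st.2 j) => [c|//].
apply: col_leD => //; rewrite -(local_pivotP E) (rho_ok _ _ F).
exact: A_ok.
Qed.

Lemma step1_col_ok st i : state_ok st -> state_ok (step1_col st i).
Proof.
move=> ok; have [A_ok rho_ok] := ok; split=> [c r|j k] /=.
  rewrite !mxE; have [->|_] := eqVneq c i.
    exact: (reduce_le ok (A_ok i)).
  by have := A_ok c r; rewrite mxE.
case E: (local_pivot _ _) => [j'|]; last exact: rho_ok.
rewrite ffunE; have [->|_] := eqVneq j j'; last exact: rho_ok.
by move=> [<-]; exact: local_pivotP E.
Qed.

Lemma step1_ok : state_ok step1.
Proof.
rewrite /step1; set st := (_, _).
have: state_ok st.
  split=> [i j|j k]; last by rewrite ffunE.
  by rewrite mxE; exact: bmx_le.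
by elim: (enum _) st => //= i s IHs st /(step1_col_ok i)/IHs.
Qed.

Lemma step2_col_le c : col_le (cgr c) (step2_col c).
Proof.
rewrite /step2_col; have [A_ok rho_ok] := step1_ok.
elim: (rev _) (col c step1.1) (A_ok c) => //= j s IHs v gv; apply: IHs.
rewrite /eliminate1; case: ifP => // vj; case E: (step1.2 j) => [k|//].
apply: col_leD => //; apply: col_leS (A_ok k).
by rewrite -(rho_ok _ _ E); exact: gv.
Qed.

Lemma enum_val_homo (k : nat) (A : pred 'I_k) (i j : 'I_#|A|) :
  (i <= j)%N -> (enum_val i <= enum_val j)%N.
Proof.
move=> ij; have x0 := enum_val i; rewrite !(enum_val_nth x0).
have : sorted leq [seq val x | x <- enum A].
  rewrite sorted_map; apply: sorted_filter; first by move=> ? ? ?; exact: leq_trans.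
  by rewrite -enumT -sorted_map val_enum_ord; exact: iota_sorted.
move=> /(sorted_leq_nth leq_trans leqnn 0%N)/(_ i j).
rewrite !inE size_map -!cardE !(nth_map x0) -?cardE //; exact.
Qed.

Lemma lazy_mx_le i c : lazy_mx i c != 0 -> grade_le (lazy_rgr i) (lazy_cgr c).
Proof. by rewrite mxE => /step2_col_le. Qed.

Lemma lazy_rgr_colex (i i' : 'I_#|kept_row|) :
  (i <= i')%N -> colex_le (lazy_rgr i) (lazy_rgr i').
Proof. by move=> /enum_val_homo; exact: rgr_colex. Qed.

Lemma lazy_cgr_colex (c c' : 'I_#|kept_col|) :
  (c <= c')%N -> colex_le (lazy_cgr c) (lazy_cgr c').
Proof. by move=> /enum_val_homo; exact: cgr_colex. Qed.

Definition lazy_minimization : bimat :=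
  Bimat lazy_mx_le lazy_rgr_colex lazy_cgr_colex.

End LazyMinimization.

(* Main.v *)
From HB Require Import structures.
From mathcomp Require Import all_boot all_order all_algebra.
From mathcomp Require Import boolp classical_sets functions.
From mathcomp Require Import mpoly.
Require Import Defs.

Set Implicit Arguments.
Unset Strict Implicit.
Unset Printing Implicit Defensive.
Import Order.TTheory GRing.Theory Num.Theory.
Local Open Scope ring_scope.
Local Open Scope classical_set_scope.

(** Lazy minimization multiplies [P] on the right by a graded unitriangular
    matrix [U].  In [P U], every kept column vanishes on the local rows and has
    no local entry, while the local columns form a unitriangular block on the
    local rows.  Hence the inclusion of the kept rows identifies the cokernel of
    the output [P'] with that of [P], and extending a relation of [P'] by zero
    and applying [U] gives a relation of [P].

    With [m = (x, y)], a free module and its standard basis give a minimal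
    presentation as soon as [im p] lies in [m F0] and [ker p] lies in [m F1].
    The first inclusion says that no entry is local.  For the second,
    semi-minimality is used: a minimal [e] has [ker e] inside [m E1], an
    identity summand does not change the kernel, and the inclusion passes from
    [P] to [P'] because [U] is invertible. *)

(** * Spans and generating sets *)

Section LinSpan.
Variable M : persMod.
Implicit Types (S T : set M) (u v : M).

Lemma lin_span_mem S v : S v -> lin_span S v.
Proof.
move=> Sv; exists 1%N, (fun=> 1), (fun=> v); split=> //.
by rewrite big_ord1 scale1r.
Qed.

Lemma lin_span0 S : lin_span S 0.
Proof.
by exists 0%N, (fun=> 0), (fun=> 0); split=> [[]//|]; rewrite big_ord0.
Qed.

Lemma lin_spanD S u v : lin_span S u -> lin_span S v -> lin_span S (u + v).
Proof.
move=> [n [a [s [sS ->]]]] [m [b [t [tS ->]]]].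
exists (n + m)%N,
  (fun i : 'I_(n + m) => match fintype.split i with inl j => a j | inr j => b j end),
  (fun i : 'I_(n + m) => match fintype.split i with inl j => s j | inr j => t j end).
split; first by move=> i; case: fintype.split.
rewrite big_split_ord /=; congr (_ + _); apply: eq_bigr => i _.
  by rewrite -[lshift _ _]/(unsplit (inl i)) unsplitK.
by rewrite -[rshift _ _]/(unsplit (inr i)) unsplitK.
Qed.

Lemma lin_spanZ S c v : lin_span S v -> lin_span S (c *: v).
Proof.
move=> [n [a [s [sS ->]]]]; exists n, (fun i => c * a i), s; split=> //.
by rewrite scaler_sumr; apply: eq_bigr => i _; rewrite scalerA.
Qed.

Lemma lin_span_sum S (I : Type) (r : seq I) (Q : pred I) (F : I -> M) :
  (forall i, Q i -> lin_span S (F i)) -> lin_span S (\sum_(i <- r | Q i) F i).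
Proof. by move=> SF; elim/big_ind: _ => //; [exact: lin_span0|exact: lin_spanD]. Qed.

Lemma lin_span_sub S T : S `<=` lin_span T -> lin_span S `<=` lin_span T.
Proof.
move=> ST v [n [a [s [sS ->]]]].
by apply: lin_span_sum => i _; apply: lin_spanZ; exact: ST.
Qed.

(** Repeated generators are merged by adding their coefficients. With distinct generators,
    [min_hom_gens_ker] can drop one of them and keep all the others. *)
Lemma lin_span_inj S v : lin_span S v ->
  exists n (a : 'I_n -> Kxy) (s : 'I_n -> M),
    [/\ forall i, S (s i), injective s & v = \sum_(i < n) a i *: s i].
Proof.
move=> [n [a [s [sS ->]]]]; pose r := undup (codom s).
exists (size r), (fun k => \sum_(i | s i == tnth (in_tuple r) k) a i).
exists (tnth (in_tuple r)); split.
- move=> k; have := mem_tnth k (in_tuple r).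
  by rewrite mem_undup => /codomP[i ->].
- by apply/tuple_uniqP; exact: undup_uniq.
rewrite -(big_tuple _ _ (in_tuple r) xpredT
  (fun b => (\sum_(i | s i == b) a i) *: b)) /=.
under [RHS]eq_bigr do rewrite scaler_suml big_mkcond /=.
rewrite exchange_big /=; apply: eq_bigr => i _.
rewrite (bigD1_seq (s i)) ?undup_uniq ?mem_undup ?codom_f //=.
by rewrite eqxx big1 ?addr0 // => b /negPf; rewrite eq_sym => ->.
Qed.

Lemma hom_gens_replace (N S T : set M) :
  hom_gens N S -> T `<=` S -> S `<=` lin_span T -> hom_gens N T.
Proof.
move=> [Sh <-] TS ST; split; first exact: subset_trans TS Sh.
apply/seteqP; split; last exact: lin_span_sub.
by apply: lin_span_sub => v Tv; apply/lin_span_mem/TS.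
Qed.

End LinSpan.

(** * The submodule [m A] and homogeneous relations *)

Lemma ord2P (i : 'I_2) : i = ord0 \/ i = ord_max.
Proof. by case: i => [[|[|//]] ?]; [left|right]; exact: val_inj. Qed.

Section Ideal.
Variable A : persMod.
Implicit Types u v : A.

(* The submodule [m A], where [m] is the ideal generated by [x] and [y]. *)
Definition mideal : set A := [set v | exists u w, v = varx *: u + vary *: w].

Lemma mideal0 : mideal 0.
Proof. by exists 0, 0; rewrite !scaler0 addr0. Qed.

Lemma midealD u v : mideal u -> mideal v -> mideal (u + v).
Proof.
move=> [a [b ->]] [c [d ->]]; exists (a + c), (b + d).
by rewrite !scalerDr addrACA.
Qed.

Lemma midealZ c v : mideal v -> mideal (c *: v).
Proof.
move=> [a [b ->]]; exists (c *: a), (c *: b).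
by rewrite scalerDr !scalerA ![c * _]mulrC.
Qed.

Lemma mideal_sum (I : Type) (r : seq I) (Q : pred I) (F : I -> A) :
  (forall i, Q i -> mideal (F i)) -> mideal (\sum_(i <- r | Q i) F i).
Proof. by move=> SF; elim/big_ind: _ => //; [exact: mideal0|exact: midealD]. Qed.

Lemma mnm_varXY (m : 'X_{1..2}) :
  'X_[m] = varx ^+ m ord0 * vary ^+ m ord_max :> Kxy.
Proof.
rewrite varXY; congr 'X_[_]; apply/mnmP => i.
rewrite mnmDE !mulmnE !mnm1E.
by case: (ord2P i) => ->; rewrite /= mul1n mul0n ?addn0.
Qed.

Lemma midealZX (m : 'X_{1..2}) v : m != 0%MM -> mideal ('X_[m] *: v).
Proof.
rewrite mnm_varXY => m0; case E: (m ord0) => [|k]; last first.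
  exists ((varx ^+ k * vary ^+ m ord_max) *: v), 0.
  by rewrite scaler0 addr0 scalerA exprS mulrA.
case F: (m ord_max) => [|k].
  by case/eqP: m0; apply/mnmP => i; rewrite mnm0E; case: (ord2P i) => ->.
exists 0, (vary ^+ k *: v).
by rewrite scaler0 add0r scalerA expr0 mul1r -exprS.
Qed.

Lemma midealZ0 (a : Kxy) v : a@_0 = 0 -> mideal (a *: v).
Proof.
move=> a0; rewrite (mpolyE a) scaler_suml; apply: mideal_sum => m _.
rewrite -mul_mpolyC; have [->|m0] := eqVneq m 0%MM.
  by rewrite a0 mpolyC0 mul0r scale0r; exact: mideal0.
by rewrite -scalerA; apply: midealZ; exact: midealZX.
Qed.

Lemma pm_compX g v (m : 'X_{1..2}) :
  pm_comp g v -> pm_comp (g + monomial_grade m) ('X_[m] *: v).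
Proof.
rewrite mnm_varXY -scalerA => gv.
have -> : g + monomial_grade m = (g.1 + (m ord0)%:Z, g.2 + (m ord_max)%:Z).
  by case: g gv.
have : pm_comp (g.1, g.2 + (m ord_max)%:Z) (vary ^+ m ord_max *: v).
  elim: (m ord_max) => [|k IHk].
    by rewrite expr0 scale1r addr0; case: (g) gv.
  have := pm_compy IHk; rewrite scalerA -exprS /=.
  by rewrite -addrA -PoszD addn1.
elim: (m ord0) => [|k IHk] H; first by rewrite expr0 scale1r addr0.
have := pm_compx (IHk H); rewrite scalerA -exprS /=.
by rewrite -addrA -PoszD addn1.
Qed.

Lemma pm_comp_sum g (I : Type) (r : seq I) (Q : pred I) (F : I -> A) :
  (forall i, Q i -> pm_comp g (F i)) -> pm_comp g (\sum_(i <- r | Q i) F i).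
Proof.
by move=> SF; elim/big_ind: _ => //; [exact: pm_comp0|exact: pm_compD].
Qed.

Lemma pm_comp_comb n (d : 'I_n -> grade) (s : 'I_n -> A) g (w : free_mod d) :
  (forall i, pm_comp (d i) (s i)) -> pm_comp g w ->
  pm_comp g (\sum_i w i 0 *: s i).
Proof.
move=> ds gw; apply: pm_comp_sum => i _.
rewrite (mpolyE (w i 0)) scaler_suml; apply: pm_comp_sum => m _.
have [->|/gw <-] := eqVneq (w i 0)@_m 0; first by rewrite !scale0r; exact: pm_comp0.
by rewrite -mul_mpolyC -scalerA; apply: pm_compZ; exact: pm_compX.
Qed.

(* The component of degree [d i0] of the relation solves for [s i0]. *)
Lemma relation_unit_coef n (d : 'I_n -> grade) (s : 'I_n -> A)
    (a : 'I_n -> Kxy) i0 :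
  (forall i, pm_comp (d i) (s i)) -> \sum_i a i *: s i = 0 ->
  (a i0)@_0 != 0 ->
  exists2 b : 'I_n -> Kxy, b i0 = 1 & \sum_i b i *: s i = 0.
Proof.
(* The coefficients are read in the free module with generator degrees [d]. Its map to [A] preserves
   degrees, so each homogeneous part of [v] is again a relation. *)
move=> ds as0 a0; pose v : free_mod d := \col_i a i.
have [r [f [ur fP f0 vE]]] := pm_span_uniq v.
have aE i : a i = \sum_(g <- r) f g i 0.
  by have := congr1 (fun w : free_mod d => w i 0) vE; rewrite summxE mxE.
have fi g : (f g i0 0)@_0 != 0 -> g = d i0.
  move=> /(fP g) <-; case: (d i0) => d1 d2; congr pair; by rewrite /= mnm0E addr0.
have rd : d i0 \in r.
  apply: contraNT a0 => dr; rewrite aE raddf_sum big1_seq // => g /= gr.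
  by apply: contraNeq dr => /fi <-.
have fc : (f (d i0) i0 0)@_0 = (a i0)@_0.
  rewrite aE raddf_sum (bigD1_seq (d i0)) //= big1 ?addr0 // => g.
  by apply: contra_neq_eq => /fi.
exists (fun i => f (d i0) i 0); last first.
  apply: (pm_indep (s := r) (f := fun g => \sum_i f g i 0 *: s i)) => //.
    by move=> g; apply: pm_comp_comb.
  rewrite exchange_big /= -[RHS]as0; apply: eq_bigr => i _.
  by rewrite -scaler_suml aE.
(* In degree [d i0] the coefficient at [i0] is a constant, and the only nonzero constant of [K] is
   1. *)
apply/mpolyP => m; rewrite mcoeff1; have [->|m0] := eqVneq m 0%MM.
  rewrite fc; case: ((a i0)@_0) a0 => [[|[|//]] i] // _; exact: val_inj.
apply: contra_neq_eq m0 => /fP /(congr1 (fun g => g - d i0)).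
rewrite addrAC subrr add0r => /pair_equal_spec[/= [m1] [m2]].
by apply/mnmP => i; rewrite mnm0E; case: (ord2P i) => ->.
Qed.

End Ideal.

(** * Minimal generating sets and kernels inside [m A] *)

Lemma mideal_map (A B : persMod) (f : pmMor A B) v :
  mideal v -> mideal (f v).
Proof. by move=> [a [b ->]]; exists (f a), (f b); rewrite linearD !linearZ. Qed.

Lemma mideal_mcoeff0 n (gr : 'I_n -> grade) (v : free_mod gr) i :
  mideal v -> (v i 0)@_0 = 0.
Proof.
move=> [u [w ->]]; rewrite !mxE mcoeffD.
by rewrite !(rmorphM (mcoeff 0)) /= !mcoeffX !mnm1_eq0 !mul0r addr0.
Qed.

(** A Nakayama-type argument: if some coefficient of [v] in the basis [S] had a nonzero constant
    term, the relation [f v = 0] could be solved for the image of that basis element, which would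
    then be a redundant generator. *)
Lemma min_hom_gens_ker (A B : persMod) (f : pmMor A B) (S : set A) (N : set B) v :
  is_basis S -> set_inj S f -> min_hom_gens N (f @` S) -> f v = 0 -> mideal v.
Proof.
move=> [[Sh Sspan] _] finj [fS fmin] fv0.
have : lin_span S v by rewrite Sspan.
move=> /lin_span_inj[n [a [s [sS sinj vE]]]].
have /choice[d ds] : forall i, exists g, pm_comp g (f (s i)).
  by move=> i; have [g ?] := Sh _ (sS i); exists g; exact: pmm_deg.
have fE (b : 'I_n -> Kxy) : f (\sum_i b i *: s i) = \sum_i b i *: f (s i).
  by rewrite linear_sum; apply: eq_bigr => i _; rewrite linearZ.
rewrite vE; apply: mideal_sum => i0 _; apply: midealZ0.
apply/eqP/negP => /negP ai0.
have afs : \sum_i a i *: f (s i) = 0 by rewrite -fE -vE.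
have [b bi0 bs] := relation_unit_coef ds afs ai0.
pose T := f @` (S `\ s i0).
have TS : T `<=` f @` S by apply: image_subset => u [].
have Ti0 : lin_span T (f (s i0)).
  move/eqP: bs; rewrite (bigD1 i0) //= bi0 scale1r addr_eq0 => /eqP ->.
  rewrite -scaleN1r; apply/lin_spanZ/lin_span_sum => i ii0.
  apply/lin_spanZ/lin_span_mem; exists (s i) => //; split; first exact: sS.
  by move=> /sinj /eqP; exact/negP.
have TN : hom_gens N T.
  apply: hom_gens_replace fS TS _ => _ [u Su <-].
  have [->//|/eqP ui] := eqVneq u (s i0).
  by apply: lin_span_mem; exists u.
(* Minimality puts the removed image back into [T]; injectivity of [f] on [S] forbids this. *)
have : T (f (s i0)) by rewrite (fmin T) //; exists (s i0).
move=> [u [Su ui] /finj ue]; apply: ui; apply: ue; exact/mem_set.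
Qed.

Definition std_basis n : set 'cV[Kxy]_n := [set v | exists i, v = delta_mx i 0].

Lemma mcoeff0_lin_span_std n (gr : 'I_n -> grade) (N : persMod)
    (f : pmMor (free_mod gr) N) (i : 'I_n) (T : set (free_mod gr)) w :
  T `<=` [set v | exists2 j, j != i & v = delta_mx j 0] ->
  lin_span (f @` T) w -> exists2 v : free_mod gr, f v = w & v i 0 = 0.
Proof.
move=> Ti [k [a [s [sS ->]]]].
have /choice[t tS] j : exists t : free_mod gr, f t = s j /\ t i 0 = 0.
  have [u Tu <-] := sS j; exists u; split=> //.
  have [l li ->] := Ti _ Tu.
  by rewrite mxE eq_sym (negPf li).
exists (\sum_j a j *: t j).
  by rewrite linear_sum; apply: eq_bigr => j _; rewrite linearZ /= (tS j).1.
by rewrite summxE big1 // => j _; rewrite mxE (tS j).2 mulr0.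
Qed.

(** A converse of [min_hom_gens_ker]. Any preimage of the image of the [i]-th basis vector has
    [i]-th coordinate with constant term 1, whereas combinations of the other basis vectors have
    [i]-th coordinate 0. So no generator is redundant. *)
Lemma min_hom_gens_std n (gr : 'I_n -> grade) (N : persMod)
    (f : pmMor (free_mod gr) N) (R : set N) :
  (forall v : free_mod gr, f v = 0 -> forall i, (v i 0)@_0 = 0) ->
  (forall w, R w <-> exists v, f v = w) ->
  set_inj (@std_basis n) f /\ min_hom_gens R (f @` @std_basis n).
Proof.
move=> f0 Rf.
have sep i v : f v = f (delta_mx i 0) -> (v i 0)@_0 = 1.
  move=> vi; have : f (v - delta_mx i 0) = 0 by rewrite linearB /= vi subrr.
  move=> /f0/(_ i); rewrite !mxE eqxx mcoeffB mcoeff1 eqxx => /eqP.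
  by rewrite subr_eq0 => /eqP.
split.
  move=> u v; rewrite !inE => -[i ->] [j ->] /sep.
  by rewrite mxE andbT; have [->//|] := eqVneq i j; rewrite mcoeff0.
split.
  split.
    move=> _ [_ [i ->] <-]; exists (gr i); apply: pmm_deg => j m.
    rewrite mxE andbT; have [->|] := eqVneq j i; last by rewrite mcoeff0 eqxx.
    rewrite mcoeff1; case: (eqVneq m 0%MM) => [->|]; last by rewrite eqxx.
    by case: (gr i) => a b _; congr pair; rewrite /= mnm0E addr0.
  apply/seteqP; split=> w.
    move=> [k [a [s [sS ->]]]]; apply/Rf.
    have /choice[t tS] j : exists t, f t = s j by have [t _ <-] := sS j; exists t.
    exists (\sum_j a j *: t j).
    by rewrite linear_sum; apply: eq_bigr => j _; rewrite linearZ /= tS.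
  move=> /Rf[v <-]; exists n, (fun i => v i 0), (fun i => f (delta_mx i 0)).
  split=> [i|]; first by exists (delta_mx i 0) => //; exists i.
  rewrite [v in LHS]matrix_sum_delta linear_sum; apply: eq_bigr => i _.
  by rewrite big_ord1 linearZ.
move=> T TS [Th Tspan]; apply/seteqP; split=> // _ [_ [i ->] <-].
apply: contrapT => Ti.
pose T' := [set v : free_mod gr | (exists2 j, j != i & v = delta_mx j 0)].
have TT' : T `<=` f @` T'.
  move=> w Tw; have [_ [j ->] wE] := TS _ Tw; exists (delta_mx j 0) => //.
  exists j => //; apply: contra_notN Ti => /eqP <-; by rewrite wE.
have : R (f (delta_mx i 0)) by apply/Rf; exists (delta_mx i 0).
rewrite -Tspan => /(lin_span_sub (fun w Tw => lin_span_mem (TT' w Tw))).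
move=> /mcoeff0_lin_span_std-/(_ i)[//|v /sep + vi].
by rewrite vi mcoeff0.
Qed.

Lemma std_basisP n (gr : 'I_n -> grade) : is_basis (F := free_mod gr) (@std_basis n).
Proof.
have := @min_hom_gens_std n gr (free_mod gr) (pm_id (free_mod gr)) setT.
case.
- by move=> v /= -> i; rewrite mxE mcoeff0.
- by move=> w; split=> // _; exists w.
by move=> _; rewrite image_id.
Qed.

Lemma finite_free_mod n (gr : 'I_n -> grade) : finite_free (free_mod gr).
Proof.
exists n, gr, (pm_id _); exists (pm_id _); by split.
Qed.

(** * Bijective morphisms are isomorphisms *)

Section BijIso.
Variables (A B : persMod) (f : pmMor A B) (g : B -> A).
Hypotheses (fK : cancel f g) (gK : cancel g f).

Fact bij_inv_linear : linear g.
Proof. by move=> c u v; apply: (can_inj fK); rewrite linearP /= !gK. Qed.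

HB.instance Definition _ := GRing.isLinear.Build Kxy B A _ g bij_inv_linear.

(** Since [f] sends the homogeneous parts of [g v] to those of [v], independence and injectivity
    kill every part of degree other than [h]. *)
Fact bij_inv_deg h v : pm_comp h v -> pm_comp h (g v).
Proof.
move=> hv; have [s [e [us eP e0 gv]]] := pm_span_uniq (g v).
suff -> : g v = if h \in s then e h else 0.
  by case: ifP => // _; exact: pm_comp0.
(* The degree [h] is adjoined so that the subtracted [v] is counted even when [h] lies outside
   [s]. *)
pose r := undup (h :: s); pose e' k := f (e k) - (if k == h then v else 0).
have ur : uniq r := undup_uniq _.
have e'0 k : k \in r -> e' k = 0.
  apply: pm_indep => // [h'|].
    rewrite {}/e'; apply: pm_compD; first exact: pmm_deg.
    by apply: pm_compN; case: eqP => [->|_] //; exact: pm_comp0.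
  rewrite sumrB -big_mkcond /= -[X in _ - X]big_filter.
  rewrite filter_pred1_uniq ?big_seq1 ?mem_undup ?mem_head //.
  rewrite -linear_sum -(sum_supp us ur) // -?gv ?gK ?subrr //.
  by move=> l ls; rewrite mem_undup inE ls orbT.
have e'1 k : k != h -> e k = 0.
  move=> kh; case: (boolP (k \in s)) => [ks|]; last exact: e0.
  have := e'0 k; rewrite mem_undup inE ks orbT /e' (negPf kh) subr0 => /(_ isT).
  by move=> /(congr1 g); rewrite fK linear0.
rewrite gv; case: ifP => hs.
  by rewrite (bigD1_seq h) //= big1 ?addr0.
by rewrite big_seq big1 // => k ks; apply: e'1; apply: contraFneq hs => <-.
Qed.

Lemma bij_pm_iso : pm_iso f.
Proof. by exists (@PmMor B A g bij_inv_deg). Qed.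

End BijIso.

(** * The column operations of Steps 1 and 2 *)

Lemma F2_neq0 (a : K) : a != 0 -> a = 1.
Proof. by case: a => [[|[|//]] ?] // _; exact: val_inj. Qed.

Lemma F2_add_neq0 (a b : K) : a != 0 -> b != 0 -> a + b = 0.
Proof. by move=> /F2_neq0 -> /F2_neq0 ->; exact: val_inj. Qed.

(** Colex order refines the partial order, so opposite comparisons leave only equality. This is how
    index order gives information about grades. *)
Lemma grade_le_colex_anti g h : grade_le g h -> colex_le h g -> g = h.
Proof.
case: g h => [g1 g2] [h1 h2] /andP[/= le1 le2] /orP[/= lt2|/= /andP[/eqP e2 l1]].
  by move: le2; rewrite leNgt lt2.
by rewrite e2; congr pair; apply: le_anti; rewrite le1 l1.
Qed.

Section LazyColumns.
Variable P : bimat.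
Let m := nrow P.
Let n := ncol P.
Implicit Types (v w : 'cV[K]_m) (i j : 'I_m) (c k : 'I_n) (st : state P).

Lemma pivotP v j : pivot v = Some j ->
  v j 0 != 0 /\ forall i, v i 0 != 0 -> (i <= j)%N.
Proof.
rewrite /pivot; case: pickP => // l /andP[vl /forallP lmax] [<-].
by split=> // i; exact/implyP.
Qed.

Lemma pivotN v : pivot v = None -> v = 0.
Proof.
rewrite /pivot; case: pickP => // vP _; apply/colP => i; rewrite [RHS]mxE.
apply/eqP/contraT => vi.
case: (@arg_maxnP _ i (fun l => v l 0 != 0) val vi) => j vj jmax.
by have := vP j; rewrite vj => /forallP; case=> l; apply/implyP; exact: jmax.
Qed.

Lemma local_pivot_pivot g v j : local_pivot g v = Some j -> pivot v = Some j.
Proof. by rewrite /local_pivot; case: (pivot v) => // l; case: eqP => // _ []. Qed.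

(* [v] arises from column [c] of [P] by adding columns of smaller index and
   grade. *)
Definition admissible c v : Prop :=
  exists2 u : 'cV[K]_n, v = (P : 'M__) *m u &
    u c 0 = 1 /\ forall k, u k 0 != 0 -> (k <= c)%N /\ grade_le (cgr k) (cgr c).

Lemma admissible_col c : admissible c (col c P).
Proof.
exists (delta_mx c 0); first by rewrite colE.
split=> [|k]; rewrite mxE ?eqxx // andbT.
have [->|] := eqVneq k c; last by rewrite eqxx.
by rewrite leqnn grade_le_refl.
Qed.

Lemma admissibleD c k v w : (k < c)%N -> grade_le (cgr k) (cgr c) ->
  admissible c v -> admissible k w -> admissible c (v + w).
Proof.
move=> kc gkc [a -> [a1 aP]] [b -> [b1 bP]].
exists (a + b); first by rewrite mulmxDr.
split=> [|l]; rewrite mxE.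
  suff -> : b c 0 = 0 by rewrite a1 addr0.
  by apply/eqP/contraT => /bP[]; rewrite leqNgt kc.
have [->|/aP //] := eqVneq (a l 0) 0; rewrite add0r => /bP[lk glk].
by split; [exact: leq_trans lk (ltnW kc) | exact: grade_le_trans glk gkc].
Qed.

(** The loop invariant of Step 1 once the columns of index below [t] are done. *)
Definition step1_inv (t : nat) st : Prop :=
  [/\ forall c, admissible c (col c st.1),
      forall j k, st.2 j = Some k ->
        [/\ (k < t)%N, rgr j = cgr k & pivot (col k st.1) = Some j] &
      forall c, (c < t)%N -> (exists j, st.2 j = Some c) \/
        local_pivot (cgr c) (col c st.1) = None].

Lemma pivot_add v w j : pivot v = Some j -> pivot w = Some j ->
  forall l, pivot (v + w) = Some l -> (l < j)%N.
Proof.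
move=> /pivotP[vj vmax] /pivotP[wj wmax] l /pivotP[+ _].
rewrite mxE ltn_neqAle => vwl; apply/andP; split.
  apply: contraNneq vwl => /val_inj ->.
  by rewrite F2_add_neq0.
have [vl|/vmax //] := eqVneq (v l 0) 0.
by apply: wmax; move: vwl; rewrite vl add0r.
Qed.

Lemma reduceP (t : nat) st c : step1_inv t st -> c = t :> nat ->
  let v := reduce st (cgr c) (col c st.1) in
  admissible c v /\ forall j, local_pivot (cgr c) v = Some j -> st.2 j = None.
Proof.
move=> [adm rho _] ct; set g := cgr c; rewrite /reduce.
pose w r := iter r (reduce1 st g) (col c st.1).
pose stuck v := forall j, local_pivot g v = Some j -> st.2 j = None.
have step v : stuck v /\ reduce1 st g v = v \/
    exists j k, [/\ local_pivot g v = Some j, st.2 j = Some k &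
                    reduce1 st g v = v + col k st.1].
  rewrite /reduce1; case E: (local_pivot g v) => [j|].
    case F: (st.2 j) => [k|]; first by right; exists j, k.
    by left; split=> // j'; rewrite E => -[<-].
  by left; split=> // j'; rewrite E.
split.
  suff H r : admissible c (w r) by exact: H.
  elim: r => //= r IHr.
  have [[_ ->] //|[j [k [E F ->]]]] := step (w r).
  have [kt jk _] := rho _ _ F.
  apply: admissibleD (IHr) (adm k); first by rewrite ct.
  by rewrite -jk (local_pivotP E) grade_le_refl.
(* Either the loop has stopped, or each of the [r] rounds has lowered the pivot; the second case is
   impossible for [r = m]. *)
suff H r : stuck (w r) \/ exists2 j, pivot (w r) = Some j & (j + r < m)%N.
  by case: (H m) => // -[j _]; rewrite ltnNge leq_addl.
elim: r => [|r [IHr|[j pj jr]]] /=.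
- case E: (pivot (w 0)) => [j|]; first by right; exists j; rewrite ?addn0.
  by left=> j; rewrite /local_pivot E.
- by left; have [[_ ->] //|[j [k [/IHr -> ]]]] := step (w r).
have [[st_w ->]|[j' [k [E F ->]]]] := step (w r); first by left.
case G: (pivot (w r + col k st.1)) => [l|]; last first.
  by left=> l; rewrite /local_pivot G.
have [_ _ pk] := rho _ _ F.
right; exists l => //; rewrite addnS; apply: leq_ltn_trans jr.
have := pivot_add (local_pivot_pivot E) pk G.
have -> : j' = j by have := local_pivot_pivot E; rewrite pj => -[].
by rewrite ltn_add2r.
Qed.

Lemma col_set_col (A : 'M[K]_(m, n)) c v k :
  col k (set_col A c v) = if k == c then v else col k A.
Proof. by apply/colP => i; rewrite !mxE; case: eqP; rewrite ?mxE. Qed.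

Lemma step1_col_inv (t : nat) st c : c = t :> nat ->
  step1_inv t st -> step1_inv t.+1 (step1_col st c).
Proof.
move=> ct inv; have [adm rho done] := inv.
have [] := reduceP inv ct; set v := reduce _ _ _ => vadm vloc.
rewrite /step1_col -/v; split=> /= [k|j k|k].
- by rewrite col_set_col; case: eqP => [->|].
- rewrite col_set_col => E.
  have {E} : (exists2 j', local_pivot (cgr c) v = Some j' & j = j' /\ k = c) \/
      st.2 j = Some k.
    move: E; case: (local_pivot _ _) => [j'|]; last by right.
    rewrite ffunE; case: eqP => [->|_]; last by right.
    by case=> <-; left; exists j'.
  move=> [[j' vj' [-> ->]]|/rho[kt gjk pk]].
    by rewrite ct eqxx (local_pivotP vj') (local_pivot_pivot vj').
  have -> : (k == c) = false by apply: contraTF kt => /eqP ->; rewrite ct ltnn.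
  by rewrite (ltnW kt : (k < t.+1)%N).
rewrite ltnS leq_eqVlt -ct => /orP[/eqP/val_inj ->|kc].
  rewrite col_set_col eqxx; case E: (local_pivot (cgr c) v) => [j|]; last by right.
  by left; exists j; rewrite ffunE eqxx.
rewrite col_set_col.
have -> : (k == c) = false by apply: contraTF kc => /eqP ->; rewrite ltnn.
have [|[j stj]|->] := done k; [by rewrite -ct | left; exists j | by right].
case E: (local_pivot (cgr c) v) => [j'|//]; rewrite ffunE.
(* By [vloc], [rho] was undefined at the new pivot, so no earlier label is overwritten. *)
by have [jj'|//] := eqVneq j j'; move: stj; rewrite jj' (vloc _ E).
Qed.

Lemma step1_invP : step1_inv n (step1 P).
Proof.
pose st0 : state P := (bmx P, [ffun=> None]).
have inv0 : step1_inv 0 st0.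
  by split=> [c|j k|//]; [exact: admissible_col | rewrite ffunE].
suff H (s : seq 'I_n) t st : step1_inv t st -> map val s = iota t (size s) ->
    (t + size s = n)%N -> step1_inv n (foldl (@step1_col P) st s).
  by apply: (H _ 0%N) => //; rewrite ?val_enum_ord size_enum_ord.
elim: s t st => [|c s IHs] t st inv /= sE nE; first by rewrite -nE addn0.
case: sE => ct sE; apply: (IHs t.+1); first exact: step1_col_inv.
  exact: sE.
by rewrite addSnnS.
Qed.

Lemma step1_admissible c : admissible c (col c (step1 P).1).
Proof. by have [] := step1_invP. Qed.

Lemma step1_rho j k : (step1 P).2 j = Some k ->
  rgr j = cgr k /\ pivot (col k (step1 P).1) = Some j.
Proof. by have [_ rho _] := step1_invP => /rho[]. Qed.

Definition col_lt (g : grade) v : Prop :=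
  forall i, v i 0 != 0 -> grade_le (rgr i) g /\ rgr i != g.

(** The algorithm tests only the pivot, but this controls all entries: if some row of the column had
    grade [cgr c], the pivot row would come at or after it in colex order while being at most
    [cgr c], and the pivot would be local. *)
Lemma step1_col_lt c : ~~ local_col c -> col_lt (cgr c) (col c (step1 P).1).
Proof.
have [_ _ /(_ c (ltn_ord c)) done] := step1_invP => cloc.
have {done} vN : local_pivot (cgr c) (col c (step1 P).1) = None.
  by case: done => // -[j jc]; case/existsP: cloc; exists j; rewrite jc.
have [/(_ c) cle _] := step1_ok P.
move=> i vi; split; first exact: cle.
apply/eqP => ic; move: vN; rewrite /local_pivot.
case E: (pivot _) => [j|]; last by move: vi; rewrite (pivotN E) mxE eqxx.
have [vj jmax] := pivotP E.
suff -> : rgr j = cgr c by rewrite eqxx.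
by apply: grade_le_colex_anti; [exact: cle | rewrite -ic rgr_colex // jmax].
Qed.

Lemma eliminate1P c v i : ~~ local_col c ->
  admissible c v -> col_lt (cgr c) v ->
  let w := eliminate1 v i in
  [/\ admissible c w, col_lt (cgr c) w, local_row i -> w i 0 = 0 &
      forall j, (i < j)%N -> w j 0 = v j 0].
Proof.
move=> cloc vadm vlt; rewrite /eliminate1 /local_row /=.
case: ifPn => [vi|/negPn/eqP vi]; last by split.
case E: ((step1 P).2 i) => [k|]; last by split.
have [ik /pivotP[ki kmax]] := step1_rho E.
have [lei nei] := vlt _ vi.
(* Column [k] has the grade of row [i], which is strictly below that of column [c]; colex order then
   places [k] before [c]. *)
have kc : (k < c)%N.
  rewrite ltnNge; apply: contraNN nei => ck; rewrite ik; apply/eqP.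
  by apply: grade_le_colex_anti; rewrite -?ik // ik cgr_colex.
split.
- by apply: admissibleD kc _ vadm (step1_admissible k); rewrite -ik.
- move=> j; rewrite mxE; have [->|/vlt //] := eqVneq (v j 0) 0.
  rewrite add0r => kj; have [/(_ k j kj) + _] := step1_ok P.
  rewrite -ik => jei; split; first exact: grade_le_trans jei lei.
  apply: contraNneq nei => jc; apply/eqP/esym; move: jei lei; rewrite jc.
  case: (rgr i) (cgr c) => [a1 a2] [b1 b2] /andP[/= x1 x2] /andP[/= y1 y2].
  by congr pair; apply: le_anti; rewrite ?x1 ?x2.
- by rewrite mxE F2_add_neq0.
move=> j ij; rewrite mxE; suff -> : col k (step1 P).1 j 0 = 0 by rewrite addr0.
by apply/eqP/contraT => /kmax; rewrite leqNgt ij.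
Qed.

Lemma step2_colP c : ~~ local_col c ->
  [/\ admissible c (step2_col c), col_lt (cgr c) (step2_col c) &
      forall i, local_row i -> step2_col c i 0 = 0].
Proof.
move=> cloc; rewrite /step2_col; set v0 := col _ _; set s := rev _.
(* Rows are visited downwards in index, and adding a column with pivot [i] leaves rows after [i]
   unchanged. Hence the local rows of index at least [t] stay cleared. *)
suff H (t : nat) (r : seq 'I_m) v : map val r = rev (iota 0 t) ->
    admissible c v -> col_lt (cgr c) v ->
    (forall i, (t <= i)%N -> local_row i -> v i 0 = 0) ->
    let w := foldl (@eliminate1 P) v r in
    [/\ admissible c w, col_lt (cgr c) w &
      forall i, local_row i -> w i 0 = 0].
  apply: (H m) => [|||i]; first by rewrite map_rev val_enum_ord.
  - exact: step1_admissible.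
  - exact: step1_col_lt.
  - by rewrite leqNgt ltn_ord.
elim: t r v => [|t IHt] [|i r] v //=.
- by move=> _ ? ? vloc; split=> // i; exact: vloc.
- by move=> /(congr1 size); rewrite size_rev.
rewrite -[0%N :: _]/(iota 0 t.+1) -[in iota 0 _]addn1 iotaD cats1 rev_rcons.
move=> -[it rE] vadm vlt vloc.
have [wadm wlt wi wj] := eliminate1P i cloc vadm vlt.
apply: IHt => // j; rewrite leq_eqVlt => /orP[/eqP tj|tj jloc].
  by have -> : j = i by apply: val_inj; rewrite /= -tj it.
by rewrite wj ?it // vloc.
Qed.

(** The full matrix [P U], before Step 3 deletes rows and columns. *)
Definition reduced_mx : 'M[K]_(m, n) :=
  \matrix_(i, c) if local_col c then (step1 P).1 i c else step2_col c i 0.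

Lemma reduced_mx_admissible c : admissible c (col c reduced_mx).
Proof.
case: (boolP (local_col c)) => cloc.
  have -> : col c reduced_mx = col c (step1 P).1; last exact: step1_admissible.
  by apply/colP => i; rewrite !mxE cloc.
have -> : col c reduced_mx = step2_col c; last by have [] := step2_colP cloc.
by apply/colP => i; rewrite !mxE (negPf cloc).
Qed.

Lemma reduced_mxE : exists U : 'M[K]_n,
  [/\ reduced_mx = (P : 'M__) *m U, forall c, U c c = 1 &
      forall k c, U k c != 0 -> (k <= c)%N /\ grade_le (cgr k) (cgr c)].
Proof.
have /choice[u uP] : forall c, exists u : 'cV[K]_n,
    col c reduced_mx = (P : 'M__) *m u /\ u c 0 = 1 /\
    forall k, u k 0 != 0 -> (k <= c)%N /\ grade_le (cgr k) (cgr c).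
  by move=> c; have [u ? ?] := reduced_mx_admissible c; exists u.
exists (\matrix_(k, c) u c k 0); split=> [|c|k c].
- apply/matrixP => i c; have [/colP/(_ i) + _] := uP c.
  by rewrite !mxE => ->; apply: eq_bigr => k _; rewrite !mxE.
- by rewrite mxE (uP c).2.1.
by rewrite mxE; exact: (uP c).2.2.
Qed.

Lemma reduced_mx_kept c : ~~ local_col c ->
  [/\ forall i, reduced_mx i c = step2_col c i 0,
      forall i, local_row i -> reduced_mx i c = 0 &
      forall i, reduced_mx i c != 0 -> rgr i != cgr c].
Proof.
move=> cloc; have [_ clt c0] := step2_colP cloc.
have E i : reduced_mx i c = step2_col c i 0 by rewrite mxE (negPf cloc).
by split=> // i; rewrite E; [exact: c0 | case/clt].
Qed.

(** With local columns matched to their pivot rows, this is the unitriangular shape of the local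
    block. *)
Lemma reduced_mx_rho j k : (step1 P).2 j = Some k ->
  [/\ rgr j = cgr k, reduced_mx j k = 1 &
      forall i, (j < i)%N -> reduced_mx i k = 0].
Proof.
move=> E; have [jk /pivotP[kj kmax]] := step1_rho E.
have kloc : local_col k by apply/existsP; exists j; rewrite E.
split=> // [|i ji]; rewrite mxE kloc.
  by apply: F2_neq0; rewrite mxE in kj.
apply/eqP/contraT => ki; have := kmax i; rewrite mxE => /(_ ki).
by rewrite leqNgt ji.
Qed.

End LazyColumns.

(** * Isomorphic cokernels, and the kernel of a semi-minimal presentation *)

Lemma coker_iso (A' B' A B : persMod) (p' : pmMor A' B') (p : pmMor A B)
    (f : pmMor B' B) :
  (forall b', (exists a', p' a' = b') <-> (exists a, p a = f b')) ->
  (forall b, exists b' a, b = f b' + p a) ->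
  exists theta : pmMor (coker p') (coker p), pm_iso theta.
Proof.
move=> fim fsurj.
pose t (u : coker p') : coker p := coker_pi p (f (repr u)).
(* The forward half of [fim] makes the induced map independent of representatives; the backward half
   will give injectivity, and [fsurj] surjectivity. *)
have tE b' : t (coker_pi p' b') = coker_pi p (f b').
  have /coker_piP/fim := coker_reprK (coker_pi p' b').
  by rewrite linearB => /coker_piP.
have t_lin : linear t.
  move=> c u v; rewrite -(coker_reprK u) -(coker_reprK v) -linearP !tE.
  by rewrite !linearP.
pose tL : {linear coker p' -> coker p} :=
  HB.pack t (GRing.isLinear.Build Kxy (coker p') (coker p) _ t t_lin).
have t_deg g u : pm_comp g u -> pm_comp g (tL u).
  move=> [b' gb' <-]; rewrite /= tE; exists (f b') => //; exact: pmm_deg.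
have /choice[s sP] : forall u : coker p, exists b', coker_pi p (f b') = u.
  move=> u; have [b' [a uE]] := fsurj (repr u); exists b'.
  rewrite -[RHS]coker_reprK; apply/coker_piP; exists (- a).
  by rewrite uE linearN opprD addrA subrr sub0r.
exists (PmMor t_deg).
apply: (@bij_pm_iso _ _ (PmMor t_deg)
  (fun u => coker_pi p' (s u) : coker p')) => u /=.
  rewrite -[RHS](coker_reprK u); apply/coker_piP/fim.
  by rewrite linearB; apply/coker_piP; rewrite sP.
by rewrite tE sP.
Qed.

Lemma pm_iso_inj (A B : persMod) (f : pmMor A B) : pm_iso f -> injective f.
Proof. by case=> f' [fK _]; exact: can_inj fK. Qed.

Lemma pm_iso_surj (A B : persMod) (f : pmMor A B) v : pm_iso f -> exists u, f u = v.
Proof. by case=> f' [_ f'K]; exists (f' v). Qed.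

Lemma pm_iso_compose (A B C : persMod) (f : pmMor B C) (h : pmMor A B) :
  pm_iso f -> pm_iso h -> pm_iso (pm_compose f h).
Proof.
move=> [f' [fK f'K]] [h' [hK h'K]]; exists (pm_compose h' f').
by split=> v /=; rewrite ?fK ?hK ?h'K ?f'K.
Qed.

Lemma semi_minimal_ker (F1 F0 M : persMod) (p : pmMor F1 F0) v :
  is_semi_minimal_presentation p M -> p v = 0 -> mideal v.
Proof.
move=> [_ [E1 [E0 [e [H [f1 [f0 [emin _ f1iso f0iso pf]]]]]]]].
have [_ _ [phi _ [_ [S [Sbasis Sinj Smin]]]]] := emin.
have [[v1 v2] <-] := pm_iso_surj v f1iso.
(* On the summand [H] the map is the identity, so the second coordinate is zero and the first lies
   in the kernel of [e]. *)
rewrite pf -(linear0 f0) => /(pm_iso_inj f0iso) [ev1 ->].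
have [a [b v1E]] := min_hom_gens_ker Sbasis Sinj Smin ev1.
apply: mideal_map; exists (a, 0), (b, 0).
by rewrite v1E; congr pair; rewrite /= !scaler0 addr0.
Qed.

(** * Homogeneous lifts of graded matrices over [K] *)

Definition grade_monom (g h : grade) : Kxy :=
  varx ^+ `|h.1 - g.1|%N * vary ^+ `|h.2 - g.2|%N.

Lemma grade_monom_refl g : grade_monom g g = 1.
Proof. by rewrite /grade_monom !subrr !expr0 mulr1. Qed.

(** The exponents are absolute values, which add up along a chain of grades. *)
Lemma grade_monom_mul g h k : grade_le g h -> grade_le h k ->
  grade_monom g h * grade_monom h k = grade_monom g k.
Proof.
have abs_add (a b c : int) : a <= b -> b <= c ->
    `|c - a|%N = (`|b - a| + `|c - b|)%N.
  move=> ab bc; apply/eqP; rewrite -eqz_nat PoszD !gez0_abs ?subr_ge0 //.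
    by rewrite [eqbRHS]addrC addrA subrK.
  exact: le_trans ab bc.
move=> /andP[g1 g2] /andP[h1 h2].
by rewrite /grade_monom (abs_add _ _ _ g1 h1) (abs_add _ _ _ g2 h2) !exprD mulrACA.
Qed.

Lemma grade_monom_mcoeff0 g h : g != h -> (grade_monom g h)@_0 = 0.
Proof.
move=> gh; rewrite /grade_monom varXY mcoeffX; case: eqP => // /mnmP m0.
have := m0 ord_max; have := m0 ord0.
rewrite !mnmDE !mulmnE !mnm1E !mnm0E /= !mul0n !mul1n ?addn0 ?add0n.
move=> /eqP + /eqP; rewrite !absz_eq0 !subr_eq0 => /eqP e1 /eqP e2.
by move: gh; rewrite (surjective_pairing g) (surjective_pairing h) e1 e2 eqxx.
Qed.

Definition graded_mx m n (rg : 'I_m -> grade) (cg : 'I_n -> grade)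
    (A : 'M[K]_(m, n)) : Prop :=
  forall i j, A i j != 0 -> grade_le (rg i) (cg j).

(** By conversion [rep_mx P] is the lift of [P]; the general form also covers [U] and [P U]. *)
Definition lift_mx m n (rg : 'I_m -> grade) (cg : 'I_n -> grade)
    (A : 'M[K]_(m, n)) : 'M[Kxy]_(m, n) :=
  \matrix_(i, j) ((A i j)%:MP * grade_monom (rg i) (cg j)).

Lemma lift_mxM m n k (rg : 'I_m -> grade) (sg : 'I_n -> grade)
    (cg : 'I_k -> grade) (A : 'M[K]_(m, n)) (B : 'M[K]_(n, k)) :
  graded_mx rg sg A -> graded_mx sg cg B ->
  lift_mx rg sg A *m lift_mx sg cg B = lift_mx rg cg (A *m B).
Proof.
move=> gA gB; apply/matrixP => i j; rewrite !mxE raddf_sum mulr_suml /=.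
apply: eq_bigr => l _; rewrite !mxE mpolyCM mulrACA.
have [->|/gA Ail] := eqVneq (A i l) 0; first by rewrite !mpolyC0 !mul0r.
have [->|/gB Blj] := eqVneq (B l j) 0; first by rewrite !mpolyC0 mulr0 !mul0r.
by rewrite grade_monom_mul.
Qed.

Lemma lift_mx_unit n (g : 'I_n -> grade) (U : 'M[K]_n) :
  (forall c, U c c = 1) -> (forall k c, U k c != 0 -> (k <= c)%N) ->
  lift_mx g g U \in unitmx.
Proof.
move=> U1 Utrig; rewrite unitmxE -det_tr det_trig.
  rewrite big1 ?unitr1 // => c _.
  by rewrite !mxE U1 grade_monom_refl mulr1 mpolyC1.
apply/is_trig_mxP => k c kc; rewrite !mxE.
have [->|/Utrig] := eqVneq (U c k) 0; first by rewrite mpolyC0 mul0r.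
by rewrite leqNgt kc.
Qed.

Lemma mulmx_mcoeff0l m n (A : 'M[Kxy]_(m, n)) (v : 'cV[Kxy]_n) i :
  (forall j, (A i j)@_0 = 0) -> ((A *m v) i 0)@_0 = 0.
Proof.
move=> A0; rewrite mxE raddf_sum big1 // => j _.
by rewrite /= (rmorphM (mcoeff 0)) /= A0 mul0r.
Qed.

Lemma mulmx_mcoeff0r m n (A : 'M[Kxy]_(m, n)) (v : 'cV[Kxy]_n) i :
  (forall j, (v j 0)@_0 = 0) -> ((A *m v) i 0)@_0 = 0.
Proof.
move=> v0; rewrite mxE raddf_sum big1 // => j _.
by rewrite /= (rmorphM (mcoeff 0)) /= v0 mulr0.
Qed.

(** * Pivots and coordinate selection for matrices *)

Lemma col_sum_delta (R : nzRingType) n (v : 'cV[R]_n) :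
  v = \sum_i v i 0 *: delta_mx i 0.
Proof.
by rewrite [LHS]matrix_sum_delta; apply: eq_bigr => i _; rewrite big_ord1.
Qed.

Lemma delta_mx_pivot (R : nzRingType) m n (A : 'M[R]_(m, n)) i k :
  A i k = 1 -> delta_mx i 0 =
    A *m delta_mx k 0 - \sum_(j | j != i) A j k *: delta_mx j 0 :> 'cV_m.
Proof.
move=> Aik; apply/eqP; rewrite eq_sym subr_eq -colE; apply/eqP.
rewrite [LHS]col_sum_delta (bigD1 i) //= mxE Aik scale1r; congr (_ + _).
by apply: eq_bigr => j _; rewrite mxE.
Qed.

Section Select.
Variables (R : comNzRingType) (n : nat) (A : pred 'I_n).

(** Multiplying by it on the left extends by zero outside [A]; multiplying by it on the right keeps
    the columns in [A]. *)
Definition select_mx : 'M[R]_(n, #|A|) := \matrix_(i, j) (enum_val j == i)%:R.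

Lemma mulmx_select m (B : 'M[R]_(m, n)) i j :
  (B *m select_mx) i j = B i (enum_val j).
Proof.
rewrite mxE (bigD1 (enum_val j)) //= mxE eqxx mulr1 big1 ?addr0 // => k.
by rewrite mxE eq_sym => /negPf ->; rewrite mulr0.
Qed.

Lemma select_mulmx m (B : 'M[R]_(#|A|, m)) i j :
  (select_mx *m B) (enum_val i) j = B i j.
Proof.
rewrite mxE (bigD1 i) //= mxE eqxx mul1r big1 ?addr0 // => k.
by rewrite mxE (inj_eq enum_val_inj) => /negPf ->; rewrite mul0r.
Qed.

Lemma select_mulmx_out m (B : 'M[R]_(#|A|, m)) i j :
  i \notin A -> (select_mx *m B) i j = 0.
Proof.
move=> iA; rewrite mxE big1 // => k _; rewrite mxE.
by case: eqP iA => [<-|]; rewrite ?enum_valP ?mul0r.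
Qed.

Lemma select_restrict m (B : 'M[R]_(n, m)) :
  (forall i j, i \notin A -> B i j = 0) ->
  select_mx *m \matrix_(i, j) B (enum_val i) j = B.
Proof.
move=> B0; apply/matrixP => i j; case: (boolP (i \in A)) => iA.
  by rewrite -(enum_rankK_in iA iA) select_mulmx mxE.
by rewrite select_mulmx_out // B0.
Qed.

Lemma select_inj m : injective (fun B : 'M[R]_(#|A|, m) => select_mx *m B).
Proof.
move=> B C BC; apply/matrixP => i j; move/matrixP/(_ (enum_val i) j): BC.
by rewrite !select_mulmx.
Qed.

End Select.

(** * The cokernel and the kernel of the output *)

Section LazyPresentation.
Variable P : bimat.
Let m := nrow P.
Let n := ncol P.
Let P' := lazy_minimization P.
Let Rm : 'M[Kxy]_(m, n) := lift_mx (@rgr P) (@cgr P) (reduced_mx P).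
Let Er : 'M[Kxy]_(m, _) := select_mx Kxy (@kept_row P).
Let Ec : 'M[Kxy]_(n, _) := select_mx Kxy (@kept_col P).

Lemma kept_rowE i : (i \in @kept_row P) = ~~ local_row i.
Proof. by []. Qed.

Lemma kept_colE c : (c \in @kept_col P) = ~~ local_col c.
Proof. by []. Qed.

Lemma lift_reduced_mx : exists2 V : 'M[Kxy]_n, V \in unitmx & Rm = rep_mx P *m V.
Proof.
have [U [RE U1 Ule]] := reduced_mxE P.
exists (lift_mx (@cgr P) (@cgr P) U).
  by apply: lift_mx_unit => // k c /Ule[].
rewrite /Rm RE -(lift_mxM (sg := @cgr P)) //; first exact: bmx_le.
by move=> k c /Ule[].
Qed.

(** Kept columns vanish on the local rows, so deleting these rows and extending by zero loses
    nothing. *)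
Lemma reduced_mx_select : Rm *m Ec = Er *m rep_mx P'.
Proof.
apply/matrixP => i c; rewrite mulmx_select.
have := enum_valP c; rewrite kept_colE => /reduced_mx_kept[RE R0 _].
case: (boolP (i \in @kept_row P)) => iA; last first.
  rewrite select_mulmx_out // mxE R0 ?mpolyC0 ?mul0r //.
  by move: iA; rewrite kept_rowE negbK.
rewrite -(enum_rankK_in iA iA) select_mulmx [LHS]mxE RE.
by rewrite [RHS]mxE [bmx P' _ _]mxE.
Qed.

Lemma rep_mx_lazy_mcoeff0 i c : (rep_mx P' i c)@_0 = 0.
Proof.
rewrite mxE mcoeffCM; have [->|] := eqVneq (P' i c) 0; first by rewrite mul0r.
rewrite mxE; have := enum_valP c; rewrite kept_colE => /reduced_mx_kept[RE _ Rne].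
by rewrite -RE => /Rne /grade_monom_mcoeff0 ->; rewrite mulr0.
Qed.

Lemma reduced_mx_coker (v : 'cV[Kxy]_m) : exists v' w, v = Er *m v' + Rm *m w.
Proof.
pose Q (u : 'cV[Kxy]_m) := exists v' w, u = Er *m v' + Rm *m w.
have QD u w : Q u -> Q w -> Q (u + w).
  move=> [a [b ->]] [c [d ->]]; exists (a + c), (b + d).
  by rewrite !mulmxDr addrACA.
have QZ a u : Q u -> Q (a *: u).
  move=> [b [c ->]]; exists (a *: b), (a *: c).
  by rewrite -!scalemxAr scalerDr.
have Qsum (I : finType) (B : pred I) F :
    (forall i, B i -> Q (F i)) -> Q (\sum_(i | B i) F i).
  move=> QF; elim/big_ind: _ => //; exists 0, 0; by rewrite !mulmx0 addr0.
suff Qdelta i : Q (delta_mx i 0).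
  by rewrite -/(Q v) [v]col_sum_delta; apply: Qsum => i _; exact: QZ.
(* Strong induction on the row index: a local basis vector is, modulo the image, a combination of
   earlier ones. *)
have [t] := ubnP (val i); elim: t i => // t IHt i; rewrite ltnS => it.
case E: ((step1 P).2 i) => [k|]; last first.
  have iA : i \in @kept_row P by rewrite kept_rowE /local_row E.
  exists (delta_mx (enum_rank_in iA i) 0), 0; rewrite mulmx0 addr0 -colE.
  by apply/colP => j; rewrite !mxE (enum_rankK_in iA iA) andbT eq_sym.
have [ik Rik R0] := reduced_mx_rho E.
have Rmik : Rm i k = 1 by rewrite mxE Rik ik grade_monom_refl mulr1 mpolyC1.
rewrite (delta_mx_pivot Rmik).
apply: QD; first by exists 0, (delta_mx k 0); rewrite mulmx0 add0r.
rewrite -scaleN1r; apply/QZ/Qsum => j ji; case: (ltngtP j i) => ij.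
- by apply/QZ/IHt; exact: leq_trans ij it.
- rewrite mxE R0 // mpolyC0 mul0r scale0r.
  by exists 0, 0; rewrite !mulmx0 addr0.
by move: ji; rewrite (val_inj ij) eqxx.
Qed.

(** The left side vanishes on local rows. Back substitution in the unitriangular block then makes
    [w] vanish on local columns, leaving a combination of kept columns. *)
Lemma reduced_mx_im (v' : 'cV[Kxy]_#|@kept_row P|) w :
  Er *m v' = Rm *m w -> exists w', v' = rep_mx P' *m w'.
Proof.
move=> vw.
(* The induction runs from the last row to the first; [t] bounds the distance of row [j] from the
   end. *)
have w0 t (j : 'I_m) k : (m <= j + t)%N -> (step1 P).2 j = Some k -> w k 0 = 0.
  elim: t j k => [|t IHt] j k jt E.
    by move: jt; rewrite addn0 leqNgt ltn_ord.
  have [jk Rjk _] := reduced_mx_rho E.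
  have : (Rm *m w) j 0 = 0.
    by rewrite -vw select_mulmx_out // kept_rowE negbK /local_row E.
  rewrite mxE (bigD1 k) //= mxE Rjk jk grade_monom_refl mulr1 mpolyC1 mul1r.
  (* Every other term vanishes: a kept column is zero in the local row [j], a column with pivot
     before [j] is zero there, and one with pivot after [j] has coefficient zero by induction. *)
  rewrite big1 ?addr0 // => c ck; rewrite mxE.
  case: (boolP (local_col c)) => cloc; last first.
    have [_ -> //] := reduced_mx_kept cloc; first by rewrite mpolyC0 !mul0r.
    by rewrite /local_row E.
  have [i /eqP ic] := existsP cloc; have [_ _ R0] := reduced_mx_rho ic.
  case: (ltngtP i j) => ij; first by rewrite R0 // mpolyC0 !mul0r.
    rewrite (IHt i c) ?mulr0 //.
    by apply: leq_trans jt _; rewrite addnS -addSn leq_add2r.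
  by move: ic ck; rewrite (val_inj ij) E => -[->]; rewrite eqxx.
exists (\col_c w (enum_val c) 0).
apply: (@select_inj Kxy _ (@kept_row P)); rewrite -/Er vw.
rewrite mulmxA -reduced_mx_select -mulmxA; congr (_ *m _).
rewrite -[LHS](@select_restrict Kxy _ (@kept_col P)).
  by congr (_ *m _); apply/matrixP => c j; rewrite !mxE ord1.
move=> c j; rewrite ord1 kept_colE negbK => /existsP[i /eqP ic].
by apply: (w0 m i) => //; rewrite leq_addl.
Qed.

(** The vector [V *m (Ec *m w)] lies in the kernel of [P]. Applying the inverse of [V] preserves
    zero constant terms, and the kept coordinates of [Ec *m w] are those of [w]. *)
Lemma lazy_ker_mcoeff0 (w : free_mod (@cgr P')) c :
  (forall v : free_mod (@cgr P), rep_mx P *m v = 0 -> forall i, (v i 0)@_0 = 0) ->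
  rep_mx P' *m w = 0 -> (w c 0)@_0 = 0.
Proof.
move=> kerP w0; have [V Vu RE] := lift_reduced_mx.
have : rep_mx P *m (V *m (Ec *m w)) = 0.
  by rewrite mulmxA -RE mulmxA reduced_mx_select -mulmxA w0 mulmx0.
move=> /kerP kv; have := mulmx_mcoeff0r (invmx V) (enum_val c) kv.
by rewrite mulKmx // select_mulmx.
Qed.

Definition keep_fun (v : free_mod (@rgr P')) : free_mod (@rgr P) := Er *m v.

Fact keep_fun_linear : linear keep_fun.
Proof. by move=> c u v; exact: (linearP (mulmx Er) c u v). Qed.

HB.instance Definition _ := GRing.isLinear.Build Kxy
  (free_mod (@rgr P')) (free_mod (@rgr P)) _ keep_fun keep_fun_linear.

Fact keep_fun_deg g v : pm_comp g v -> pm_comp g (keep_fun v).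
Proof.
move=> gv i a; case: (boolP (i \in @kept_row P)) => iA.
  by rewrite -(enum_rankK_in iA iA) select_mulmx => /gv.
by rewrite select_mulmx_out // mcoeff0 eqxx.
Qed.

Definition keep_mor : pmMor (free_mod (@rgr P')) (free_mod (@rgr P)) :=
  PmMor keep_fun_deg.

Lemma lazy_coker_iso :
  exists theta : pmMor (coker (rep_mor P')) (coker (rep_mor P)), pm_iso theta.
Proof.
have [V Vu RE] := lift_reduced_mx.
apply: (@coker_iso _ _ _ _ _ _ keep_mor) => [v'|v].
  split=> [[w <-]|[a aE]].
    exists (V *m (Ec *m w)).
    by rewrite /= /rep_fun mulmxA -RE mulmxA reduced_mx_select -mulmxA.
  have [|w' ->] := @reduced_mx_im v' (invmx V *m a); last by exists w'.
  by rewrite RE -mulmxA mulKVmx.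
have [v' [w ->]] := reduced_mx_coker v.
by exists v', (V *m w); rewrite /= /rep_fun mulmxA -RE.
Qed.

End LazyPresentation.

Theorem propositionB1 (M : persMod) (P : bimat) :
  is_semi_minimal_presentation (rep_mor P) M ->
  is_minimal_presentation (rep_mor (lazy_minimization P)) M.
Proof.
move=> Psemi; have [[_ _ [phi phi_iso]] _] := Psemi.
have kerP (v : free_mod (@cgr P)) : rep_mx P *m v = 0 ->
    forall i, (v i 0)@_0 = 0.
  by move=> v0 i; apply: mideal_mcoeff0; exact: (semi_minimal_ker Psemi).
have [theta theta_iso] := lazy_coker_iso P.
set P' := lazy_minimization P; set p' := rep_mor P'.
pose psi := pm_compose phi theta.
have psi_iso : pm_iso psi by exact: pm_iso_compose.
split; [exact: finite_free_mod | exact: finite_free_mod |].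
exists psi => // q.
have kerq w : q w = 0 <-> exists v, p' v = w.
  rewrite -{2}(subr0 w) -coker_piP linear0; split=> [|wE].
    by rewrite -(linear0 psi) => /(pm_iso_inj psi_iso).
  by rewrite /q /= -/(coker_pi p' w) wE !linear0.
split.
  exists (@std_basis _).
  (* For the generators, the kernel of [q] is the image of [p'], whose matrix has no constant
     terms. *)
  have [] := @min_hom_gens_std _ _ _ q setT; last by split=> //; exact: std_basisP.
    move=> v /kerq[w <-] i; apply: mulmx_mcoeff0l => c.
    exact: rep_mx_lazy_mcoeff0.
  move=> w; split=> // _; have [u <-] := pm_iso_surj w psi_iso.
  by exists (repr u); rewrite /q /= coker_reprK.
exists (@std_basis _).
(* For the relations, the condition on the kernel of [p'] is inherited from [P]. *)
have [] := @min_hom_gens_std _ _ _ p' [set v | q v = 0]; last first.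
- by split=> //; exact: std_basisP.
- exact: kerq.
by move=> v v0 i; exact: lazy_ker_mcoeff0 v0.
Qed.
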